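(* Assume that $\mathrm{MA(countable)}$ holds. Then there exists a non-principal ultrafilter $\mathcal{U}\subseteq 2^\omega$ on $\omega$ that is completely Baire.
   Context: Every subset of $\omega$ is identified with its characteristic function, so an ultrafilter on $\omega$ is regarded as a subset of the Cantor set $2^\omega$ and carries the subspace topology. A (separable metrizable) space $X$ is completely Baire if every closed subspace of $X$ is a Baire space. $\mathrm{MA(countable)}$ (Martin's Axiom for countable posets) is the statement: for every non-empty countable partially ordered set $\mathbb{P}$ and every collection $\mathcal{D}$ of dense subsets of $\mathbb{P}$ with $|\mathcal{D}|<\mathfrak{c}=2^{\aleph_0}$, there is a filter $G\subseteq\mathbb{P}$ that meets every element of $\mathcal{D}$. *)

(* Defs.v *)
From mathcomp Require Import all_boot all_order.
From mathcomp Require Import all_classical topology cantor.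

Set Implicit Arguments.
Unset Strict Implicit.
Unset Printing Implicit Defensive.

Import Order.TTheory.
Local Open Scope classical_set_scope.
Local Open Scope card_scope.

Definition card_lt (T U : Type) (A : set T) (B : set U) : bool :=
  (A #<= B) && ~~ (A #= B).

(* Forcing convention: smaller elements are stronger conditions. *)
Section PosetForcing.
Context {d : Order.disp_t} {P : porderType d}.

Definition poset_dense (D : set P) : Prop :=
  forall p : P, exists2 q : P, D q & (q <= p)%O.

Definition poset_filter (G : set P) : Prop :=
  [/\ G !=set0,
      (forall p q : P, G p -> (p <= q)%O -> G q) &
      (forall p q : P, G p -> G q -> exists r : P, [/\ G r, (r <= p)%O & (r <= q)%O])].

End PosetForcing.

(* [countable] allows finite posets. *)
Definition MA_countable : Prop :=
  forall (d : Order.disp_t) (P : porderType d) (DD : set (set P)),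
    [set: P] !=set0 -> countable [set: P] ->
    (forall D : set P, DD D -> poset_dense D) ->
    card_lt DD [set: nat -> bool] ->
    exists G : set P, poset_filter G /\ (forall D : set P, DD D -> G `&` D !=set0).

Definition baire_space (X : topologicalType) : Prop :=
  forall O : nat -> set X,
    (forall n : nat, open (O n) /\ dense (O n)) -> dense (\bigcap_n O n).

(* [set_type C] carries the subset topology on the points of [C]; the library's
   [subspace C] instead keeps the points outside [C], as isolated points. *)
Definition completely_baire (X : topologicalType) : Prop :=
  forall C : set X, closed C -> baire_space (set_type C).

Definition char_fun (A : set nat) : cantor_space := fun n : nat => n \in A.

Definition char_set (F : set_system nat) : set cantor_space := char_fun @` F.

Definition nonprincipal (F : set_system nat) : Prop :=
  forall n : nat, F <> principal_filter n.

(* Main.v *)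
Require Import Defs.
From HB Require Import structures.
From Stdlib Require Import Wellfounded.
From mathcomp Require Import all_boot all_order.
From mathcomp Require Import all_classical topology cantor.

Set Implicit Arguments.
Unset Strict Implicit.
Unset Printing Implicit Defensive.
Local Open Scope classical_set_scope.
Local Open Scope card_scope.

(** The ultrafilter is built in continuum many steps from a transfinite sequence
of sets.  A family is kept strongly centered throughout, meaning that finite
intersections of its members are infinite, so that it extends to a
non-principal ultrafilter.

A failure of complete Baireness can be described by countable data.  If [C] is
closed in the ultrafilter [U], the [O n] are open and dense in [C] and [V] is
open in [C], let [S] be the tree of finite initial segments of points of [V],
and let [D n] be the set of finite sequences all of whose extensions in [C] lie
in [V] and in [O n].  It is then enough that [U] contain one point [A] having
arbitrarily long initial segments in [S] and an initial segment in every [D n]: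
the first property puts [A] in the closure of [C], hence in [C], and the second
puts it in [V] and in all the [O n].

There are only continuum many pairs [(S, D)], so each of them can be given a
step, at which the family [F] built so far has fewer than continuum many
members.  If some [A] as above keeps [F] centered, one such [A] is added.
[generic_branch] says when this is possible: it suffices that, for every [n]
and every [s] in [S], there be a branch of [S] through [s] that meets [D n] and
keeps [F] centered.  Indeed [S], ordered by extension, is then a countable
poset in which, for all [n] and all finite parts of [F], the following is
dense: having met [D n], and having a [1] beyond [n] at an element of the
intersection of that part.  Martin's axiom yields a filter meeting these dense
sets, and the branch that it determines is the required [A].

When [(S, D)] comes from a closed [C] in the final ultrafilter, the condition
of [generic_branch] holds automatically, because the points of [V] in the
dense open set [O n] are members of [U], and [U] extends [F] and is itself
strongly centered ([generic_completely_baire]).  So the step devoted to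
[(S, D)] did add a suitable point.

Two facts on cardinals are needed: the steps can be well-ordered with all
proper initial segments smaller than the continuum ([exists_short_wo]), and a
set smaller than the continuum has fewer than continuum many finite sequences
([card_lt_nat_seq]).  The latter rests on [card_seq_le]: an uncountable [A] is
equipotent with the set of its finite sequences. *)

(** * Comparison of cardinals *)

Lemma card_leTP (T U : Type) :
  [set: T] #<= [set: U] <-> exists f : T -> U, injective f.
Proof.
split=> [/card_leP|[f fI]].
  move=> [f]; exists (fun x => val (f (SigSub (mem_set (I : [set: T] x))))).
  move=> x y /val_inj fxy.
  have /(congr1 val)// : SigSub (mem_set (I : [set: T] x)) =
      SigSub (mem_set (I : [set: T] y)).
  by apply: (@inj _ _ _ f) fxy; exact: mem_set.
have /injfunPex[g] : exists2 g : T -> U,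
    set_fun [set: T] [set: U] g & set_inj [set: T] g.
  by exists f => // x y _ _ /fI.
exact: inj_card_le.
Qed.

Lemma card_le_fun (T U : Type) (u0 : U) (X : set T) (Y : set U) : X #<= Y ->
  exists2 h, forall x, X x -> Y (h x) &
    forall x x', X x -> X x' -> h x = h x' -> x = x'.
Proof.
move=> /card_leP[f].
pose h x := if pselect (X x) is left Xx
  then val (f (SigSub (mem_set Xx))) else u0.
exists h => [x|x x'] Xx; rewrite /h; case: pselect => // Xx2.
  exact: set_mem (valP (f (SigSub (mem_set Xx2)))).
move=> Xx'; case: pselect => // Xx2' /val_inj fxx'.
have /(congr1 val)// : SigSub (mem_set Xx2) = SigSub (mem_set Xx2').
by apply: (@inj _ _ _ f) fxx'; exact: mem_set.
Qed.

Lemma bigcup_chain_seq (T : eqType) (C : set (set T)) (l : seq T) :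
  total_on C subset -> l != [::] ->
  (forall a, a \in l -> (\bigcup_(A in C) A) a) ->
  exists2 A, C A & forall a, a \in l -> A a.
Proof.
move=> totC; elim: l => // a [|b l] IH _ lC.
  have [A CA Aa] := lC a (mem_head _ _).
  by exists A => // b; rewrite inE => /eqP ->.
have [//||A CA lA] := IH.
  by move=> c cl; apply: lC; rewrite inE cl orbT.
have [B CB Ba] := lC a (mem_head _ _).
have [AB|BA] := totC _ _ CA CB.
  by exists B => // c; rewrite inE => /predU1P[->//|/lA/AB].
by exists A => // c; rewrite inE => /predU1P[->|/lA//]; exact: BA.
Qed.

(** The graphs of the partial bijections from [T] to [U]. *)
Definition matching T U (M : set (T * U)) := forall p q,
  M p -> M q -> (p.1 = q.1 <-> p.2 = q.2).

(** A maximal partial bijection between [A] and [B] exhausts one of them, since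
a pair of unmatched elements could be added to it. *)
Lemma card_le_total (T U : Type) (A : set T) (B : set U) :
  (A #<= B) || (B #<= A).
Proof.
suff : [set: A] #<= [set: B] \/ [set: B] #<= [set: A].
  by rewrite !(card_le_eql (card_setT _)) !(card_le_eqr (card_setT _)) => /orP.
have [|M [mM maxM]] := @Zorn_bigcup (A * B) (@matching A B).
  move=> C mC totC p q [M CM Mp] [N CN Nq].
  have [MN|NM] := totC _ _ CM CN; first by apply: (mC N) => //; exact: MN.
  by apply: (mC M) => //; exact: NM.
have [domM|/existsNP[a aM]] := pselect (forall a, exists b, M (a, b)).
  left; apply/card_leTP; have [f fM] := choice domM.
  by exists f => x y xy; apply/(mM _ _ (fM x) (fM y)).
right; apply/card_leTP.
have [ranM|/existsNP[b bM]] := pselect (forall b, exists a, M (a, b)).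
  have [f fM] := choice ranM.
  by exists f => x y xy; apply/(mM _ _ (fM x) (fM y)).
case: (maxM (M `|` [set (a, b)])).
  split; first exact: subsetUl.
  by move=> /(_ (a, b) (or_intror erefl)) Mab; apply: aM; exists b.
move=> [x y] [x' y'] /= [Mp|[-> ->]] [Mq|[-> ->]] //.
- exact: (mM _ _ Mp Mq).
- by split=> e; subst; [case: aM; exists y|case: bM; exists x].
- by split=> e; subst; [case: aM; exists y'|case: bM; exists x'].
Qed.

(** * Finite sequences over an infinite set *)

Section seq_card.
Variable A : eqType.
Implicit Types (G : set (seq A * A)) (X Y : set A) (l : seq A).

(** When [G] sends injectively the nonempty lists over a set [X] into [X], this
recovers [X] from [G]. *)
Definition dom1 G : set A := [set a | exists y, G ([:: a], y)].

Definition list_over X l := l != [::] /\ forall a, a \in l -> X a.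

(** The relation [G] codes the nonempty lists over [dom1 G] by elements of
[dom1 G].  Distinct lists have distinct codes, but a list may have several
codes: keeping single-valuedness out makes the notion a short closure property,
and a function can be chosen inside [G] afterwards ([listing_inj]).  The empty
list is left out so that the empty relation qualifies and chains have upper
bounds without exception. *)
Definition listing G :=
  [/\ forall l y, G (l, y) -> list_over (dom1 G) l /\ dom1 G y,
      forall l, list_over (dom1 G) l -> exists y, G (l, y) &
      forall l l' y, G (l, y) -> G (l', y) -> l = l'].

Lemma dom1_bigcup (C : set (set (seq A * A))) :
  dom1 (\bigcup_(G in C) G) = \bigcup_(G in C) dom1 G.
Proof.
apply/seteqP; split=> a [].
  by move=> y [G CG Gy]; exists G => //; exists y.
by move=> G CG [y Gy]; exists y, G.
Qed.

(** A finite list over the union of a chain is a list over one of its members. *)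
Lemma listing_bigcup (C : set (set (seq A * A))) :
  C `<=` listing -> total_on C subset -> listing (\bigcup_(G in C) G).
Proof.
move=> CL totC; rewrite /listing dom1_bigcup; split.
- move=> l y [G CG Gly]; have [/(_ _ _ Gly)[[l0 lG] Gy] _ _] := CL _ CG.
  by split; [split=> // a /lG; exists G|exists G].
- move=> l [l0 lC].
  have tot1 : total_on (dom1 @` C) subset.
    move=> _ _ [G CG <-] [H CH <-].
    have [GH|HG] := totC _ _ CG CH; [left|right] => a [y ?]; exists y.
      exact: GH.
    exact: HG.
  have lC' a : a \in l -> (\bigcup_(X in dom1 @` C) X) a.
    by move=> /lC[G CG Ga]; exists (dom1 G) => //; exists G.
  have [_ [G CG <-] lG] := bigcup_chain_seq tot1 l0 lC'.
  have [_ /(_ l)[//|y Gy] _] := CL _ CG.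
  by exists y, G.
- move=> l l' y [G CG Gy] [H CH Hy].
  have [GH|HG] := totC _ _ CG CH.
    by have [_ _ Hinj] := CL _ CH; apply: Hinj Hy; exact: GH.
  by have [_ _ Ginj] := CL _ CG; apply: Ginj Gy _; exact: HG.
Qed.

Definition list_inj X (g : seq A -> A) :=
  (forall l, list_over X l -> X (g l)) /\
  (forall l l', list_over X l -> list_over X l' -> g l = g l' -> l = l').

Lemma listing_inj (a0 : A) G : listing G -> exists2 g, list_inj (dom1 G) g &
  forall l, list_over (dom1 G) l -> G (l, g l).
Proof.
case=> GX Gex Ginj.
have /choice[g gG] : forall l, exists y, list_over (dom1 G) l -> G (l, y).
  move=> l; have [/Gex[y Gy]|nl] := pselect (list_over (dom1 G) l).
    by exists y.
  by exists a0.
exists g => //; split; first by move=> l /gG/GX[].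
by move=> l l' /gG Gl /gG Gl' e; apply: Ginj Gl _; rewrite e.
Qed.

Lemma list_over_map X Y (f : A -> A) l :
  (forall a, X a -> Y (f a)) -> list_over X l -> list_over Y (map f l).
Proof.
move=> XY [l0 lX]; split=> [|_ /mapP[a /lX Xa ->]]; last exact: XY.
by case: l l0 {lX}.
Qed.

Lemma map_over_inj X (B : Type) (f : A -> B) l l' :
  (forall a b, X a -> X b -> f a = f b -> a = b) ->
  list_over X l -> list_over X l' -> map f l = map f l' -> l = l'.
Proof.
move=> fI [_ lX] [_ l'X]; elim: l l' lX l'X => [|a l IH] [|b l'] //= lX l'X.
case=> /fI ->; [|by apply: lX; exact: mem_head|by apply: l'X; exact: mem_head].
by move=> /IH ->// c cl; [apply: lX|apply: l'X]; rewrite inE cl orbT.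
Qed.

(** If [k] injects [Y] into [X], a list over [X `|` Y] becomes a list of lists
over [X] by replacing [a] with [[:: a]] if it is in [X] and with
[[:: k a; k a]] otherwise.  Coding the inner lists and then the outer one by
[g] yields an element of [X]. *)
Lemma list_inj_setU X Y (g : seq A -> A) (k : A -> A) :
  list_inj X g -> (forall y, Y y -> X (k y)) ->
  (forall y y', Y y -> Y y' -> k y = k y' -> y = y') ->
  exists2 h, forall l, list_over (X `|` Y) l -> X (h l) &
    forall l l', list_over (X `|` Y) l -> list_over (X `|` Y) l' ->
      h l = h l' -> l = l'.
Proof.
move=> [gX gI] kX kI.
pose c a := if a \in X then [:: a] else [:: k a; k a].
have cX a : (X `|` Y) a -> list_over X (c a).
  rewrite /c.
  case: (boolP (a \in X)) => [/set_mem Xa _|/negP aX [/mem_set//|Ya]].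
    by split=> // b; rewrite inE => /eqP ->.
  by split=> // b; rewrite !inE orbb => /eqP ->; exact: kX.
have cI a b : (X `|` Y) a -> (X `|` Y) b -> c a = c b -> a = b.
  rewrite /c; case: (boolP (a \in X)); case: (boolP (b \in X)) => //.
  - by move=> _ _ _ _ [].
  - move=> /negP bX /negP aX [/mem_set//|Ya] [/mem_set//|Yb] [kab]; exact: kI.
have fX a : (X `|` Y) a -> X ((g \o c) a) by move=> /cX/gX.
have fI a b : (X `|` Y) a -> (X `|` Y) b -> (g \o c) a = (g \o c) b -> a = b.
  by move=> aXY bXY /(gI _ _ (cX _ aXY) (cX _ bXY))/cI; exact.
exists (fun l => g (map (g \o c) l)).
  by move=> l lXY; apply/gX/list_over_map/lXY.
move=> l l' lXY l'XY.
move=> /(gI _ _ (list_over_map fX lXY) (list_over_map fX l'XY)).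
exact: map_over_inj fI lXY l'XY.
Qed.

Lemma listing_graph X (h : seq A -> A) : list_inj X h ->
  listing [set p | list_over X p.1 /\ p.2 = h p.1] /\
  dom1 [set p | list_over X p.1 /\ p.2 = h p.1] = X.
Proof.
move=> [hX hI].
have domE : dom1 [set p | list_over X p.1 /\ p.2 = h p.1] = X.
  apply/seteqP; split=> a; first by case=> y [[_ /(_ a (mem_head _ _))]].
  move=> Xa; exists (h [:: a]); split=> //; split=> // b.
  by rewrite inE => /eqP ->.
split=> //; rewrite /listing domE; split.
- by move=> l y [/= lX ->]; split=> //; exact: hX.
- by move=> l lX; exists (h l).
- by move=> l l' y [/= lX ->] [/= l'X /hI]; exact.
Qed.

(** If the complement of [X := dom1 G] contains a copy [Y] of [X], the lists over
[X `|` Y] that are not over [X] can be coded by elements of [Y]: they inject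
into [X] by [list_inj_setU], hence into [Y]. *)
Lemma listing_extend G : listing G -> dom1 G !=set0 ->
  dom1 G #<= ~` dom1 G -> exists2 G', listing G' & G `<` G'.
Proof.
set X := dom1 G => LG [x0 Xx0] XleY.
have [g gI _] := listing_inj x0 LG.
have [h hY hI] : exists2 h, forall x, X x -> ~ X (h x) &
    forall x x', X x -> X x' -> h x = h x' -> x = x'.
  exact: (card_le_fun x0 XleY).
pose Y := h @` X.
have XY a : X a -> Y a -> False by move=> + [b Xb hb]; rewrite -hb; exact: hY.
have [k kX kh] : exists2 k,
    forall y, Y y -> X (k y) & forall y, Y y -> h (k y) = y.
  have /choice[k kP] : forall y, exists x, Y y -> X x /\ h x = y.
    move=> y; have [[x Xx <-]|nY] := pselect (Y y); first by exists x.
    by exists x0.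
  by exists k => y /kP[].
have [y y' Yy Yy' kyy'|e eX eI] := list_inj_setU gI kX.
  by rewrite -(kh _ Yy) -(kh _ Yy') kyy'.
pose G' := G `|` [set p |
  [/\ list_over (X `|` Y) p.1, ~ list_over X p.1 & p.2 = h (e p.1)]].
have [GX Gex Ginj] := LG.
have domG' : dom1 G' = X `|` Y.
  apply/seteqP; split=> a.
    by case=> y [Gy|[/= [_ + _ _]]]; [left; exists y|apply; exact: mem_head].
  case=> [[y Gy]|Ya]; first by exists y; left.
  exists (h (e [:: a])); right; split=> //=.
    by split=> // b; rewrite inE => /eqP ->; right.
  by move=> [_ /(_ a (mem_head _ _)) /XY]; exact.
exists G'.
  rewrite /listing domG'; split.
  - move=> l y [/GX[[l0 lX] Xy]|[/= lXY _ ->]].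
      by split; [split=> // a /lX; left|left].
    by split=> //; right; exists (e l) => //; exact: eX.
  - move=> l lXY; have [/Gex[y Gy]|nlX] := pselect (list_over X l).
      by exists y; left.
    by exists (h (e l)); right.
  - move=> l l' y [Gy|[/= lXY _ ->]] [Gy'|[/= l'XY _ yE]].
    + exact: Ginj Gy Gy'.
    + have [_ Xy] := GX _ _ Gy; rewrite yE in Xy.
      by case: (hY (e l')) => //; exact: eX.
    + have [_ Xy] := GX _ _ Gy'.
      by case: (hY (e l)) => //; exact: eX.
    + by apply: eI => //; apply: hI; rewrite ?yE//; exact: eX.
split; first exact: subsetUl.
move=> G'G; have : dom1 G' `<=` X by move=> a [y /G'G Gy]; exists y.
rewrite domG' => /(_ (h x0)) XYX; apply: (hY x0) => //; apply: XYX.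
by right; exists x0.
Qed.

End seq_card.

(** Take a maximal coding [G] of lists by elements.  Its domain [X] is nonempty,
as lists of natural numbers have codes in [nat].  By maximality the complement
of [X] is not larger than [X], so lists over the whole of [A] also have codes
in [X]. *)
Lemma card_seq_le (A : Type) :
  ~ countable [set: A] -> [set: seq A] #<= [set: A].
Proof.
elim/Peq : A => A Aunc.
have [G [LG maxG]] := Zorn_bigcup (@listing_bigcup A).
have /infiniteP/card_leTP[i iI] : infinite_set [set: A].
  by move=> /finite_set_countable.
have domG0 : dom1 G !=set0.
  apply/set0P/eqP => G0.
  have /choice[k kP] : forall a, exists n, range i a -> i n = a.
    move=> a.
    by have [[n _ <-]|nia] := pselect (range i a); [exists n|exists 0].
  have hI : list_inj (range i) (fun l => i (pickle (map k l))).
    split=> [l _|l l' lX l'X /iI/(pcan_inj pickleK)].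
      by exists (pickle (map k l)).
    by apply: map_over_inj lX l'X => a b /kP + /kP + kab; rewrite kab => -> ->.
  have [Lh domh] := listing_graph hI.
  apply: (maxG _ _ Lh); split=> [[l y] Gly|hG].
    have [/(_ _ _ Gly)[_]] := LG.
    by rewrite G0.
  have : dom1 G (i 0).
    have : range i (i 0) by exists 0.
    by rewrite -domh => -[y /hG Gy]; exists y.
  by rewrite G0.
have [a0 _] := domG0.
have [g [gX gI] _] := listing_inj a0 LG.
have [XleY|YleX] := orP (card_le_total (dom1 G) (~` dom1 G)).
  by have [G' LG' GG'] := listing_extend LG domG0 XleY; case: (maxG _ GG').
have [k kX kI] : exists2 k, forall y, (~` dom1 G) y -> dom1 G (k y) &
    forall y y', (~` dom1 G) y -> (~` dom1 G) y' -> k y = k y' -> y = y'.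
  exact: (card_le_fun a0 YleX).
have [h _ hI] := list_inj_setU (conj gX gI) kX kI.
(* Prepending a0 makes every list nonempty. *)
apply/card_leTP; exists (fun l => h (a0 :: l)) => l l' hll'.
suff : a0 :: l = a0 :: l' by case.
by apply: hI => //; rewrite setUv.
Qed.

(** * Cardinals below the continuum *)

Notation continuum := [set: nat -> bool].

Lemma card_ltE T U (A : set T) (B : set U) : card_lt A B = ~~ (B #<= A).
Proof.
rewrite /card_lt card_eq_le; have := card_le_total A B.
by case: (A #<= B); case: (B #<= A).
Qed.

Lemma card_lt_trans_le T U V (A : set T) (B : set U) (C : set V) :
  A #<= B -> card_lt B C -> card_lt A C.
Proof.
by rewrite !card_ltE => AB; apply: contra => /card_le_trans; exact.
Qed.

Lemma uncountable_continuum : ~ countable continuum.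
Proof.
rewrite /countable card_leTP => -[f fI].
have /choice[g gf] : forall n, exists x, (exists y, f y = n) -> f x = n.
  move=> n; have [[y <-]|nf] := pselect (exists y, f y = n); first by exists y.
  by exists (fun=> true).
pose d n := ~~ g n n.
have /fI/(congr1 (fun h => h (f d))) : f (g (f d)) = f d by apply: gf; exists d.
by rewrite /d; case: (g _ _).
Qed.

Lemma card_lt_nat_seq (A : Type) :
  card_lt [set: A] continuum -> card_lt [set: nat * seq A] continuum.
Proof.
rewrite !card_ltE; apply: contra => cA.
have [/card_leTP[f fI]|Aunc] := pselect (countable [set: A]).
  case: uncountable_continuum; apply: card_le_trans cA _.
  apply/card_leTP; exists (fun p => pickle (p.1, map f p.2)).
  by move=> [n s] [m t] /(pcan_inj pickleK)[-> /(inj_map fI) ->].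
have /card_leTP[g gI] := card_seq_le Aunc.
apply: card_le_trans cA _; apply/card_leTP.
(* The number is stored as the length of a list of lists. *)
exists (fun p => g (map g (p.2 :: nseq p.1 [::]))).
move=> [n s] [m t] /gI/(inj_map gI)[-> /(congr1 size)].
by rewrite !size_nseq => ->.
Qed.

(** * Well-orders with short initial segments *)

Definition strict_wo T (lt : T -> T -> Prop) :=
  [/\ well_founded lt, forall x y z, lt x y -> lt y z -> lt x z &
      forall x y, [\/ x = y, lt x y | lt y x]].

Lemma well_founded_min T (lt : T -> T -> Prop) (A : set T) :
  well_founded lt -> A !=set0 ->
  exists2 x, A x & forall y, lt y x -> ~ A y.
Proof.
move=> wf [x Ax]; apply: contrapT => nmin.
elim/(well_founded_ind wf) : x Ax => x IH Ax.
by apply: nmin; exists x => // y /IH.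
Qed.

Lemma exists_strict_wo (T : eqType) : exists lt : T -> T -> Prop, strict_wo lt.
Proof.
have [R Rwo] := wochoice.well_ordering_principle T.
have Rmin (A : {pred T}) : wochoice.nonempty A ->
    exists2 z, z \in A & forall x, x \in A -> R z x.
  by move=> /Rwo[z [[Az zmin] _]]; exists z.
have Rxx x : R x x.
  have [|_ /eqP -> ] := Rmin (pred1 x); first by exists x; exact: eqxx.
  by apply; exact: eqxx.
have Ranti x y : R x y -> R y x -> x = y.
  move=> xy yx; have [|z [_ zuniq]] := Rwo (pred2 x y).
    by exists x; rewrite inE eqxx.
  rewrite -(zuniq x) ?(zuniq y)//; split; rewrite ?inE ?eqxx ?orbT//.
    by move=> w; rewrite inE => /orP[/eqP ->|/eqP ->].
  by move=> w; rewrite inE => /orP[/eqP ->|/eqP ->].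
exists (fun x y => ~~ R y x); split.
- move=> x; apply: contrapT => nx.
  have [|z] := Rmin (fun x => `[< ~ Acc (fun x y => ~~ R y x) x >]).
    by exists x; apply/asboolP.
  rewrite unfold_in => /asboolP nz zmin; apply: nz; constructor=> y.
  by apply: contraNP => ny; apply: zmin; rewrite unfold_in; apply/asboolP.
- move=> x y z; have [|w] := Rmin (pred3 x y z).
    by exists x; rewrite inE eqxx.
  rewrite inE => /or3P[] /eqP -> wmin.
  + move=> nyx nzy; apply: contra nzy => zx.
    rewrite (Ranti _ _ zx); first by apply: wmin; rewrite !inE eqxx orbT.
    by apply: wmin; rewrite !inE eqxx !orbT.
  + by rewrite wmin// inE eqxx.
  + by move=> _; rewrite wmin// !inE eqxx orbT.
- move=> x y; case: (boolP (R y x)) => yx; last by constructor 2.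
  case: (boolP (R x y)) => xy; last by constructor 3.
  by constructor 1; exact: Ranti.
Qed.

(** Start from any well-order.  If some proper initial segment has the size of the
continuum, the shortest such segment receives an injection of [T], along which
the order is pulled back. *)
Lemma exists_short_wo (T : eqType) : [set: T] #<= continuum ->
  exists2 lt : T -> T -> Prop, strict_wo lt &
    forall t, card_lt [set s | lt s t] continuum.
Proof.
move=> Tc; have [lt [wf tr tot]] := exists_strict_wo T.
have [short|/existsNP long] :=
  pselect (forall t, card_lt [set s | lt s t] continuum).
  by exists lt.
have [t tlong tmin] := well_founded_min wf long.
have [|f flt fI] := @card_le_fun T T t [set: T] [set s | lt s t].
  by apply: card_le_trans Tc _; move/negP: tlong; rewrite card_ltE negbK.
exists (fun x y => lt (f x) (f y)).
  split; first exact: wf_inverse_image.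
    by move=> x y z; exact: tr.
  move=> x y; case: (tot (f x) (f y)) => [/fI->//||].
  - by constructor 1.
  - by constructor 2.
  - by constructor 3.
move=> x; apply: (@card_lt_trans_le _ _ _ _ [set s | lt s (f x)]).
  have /injfunPex[h] : exists2 h : T -> T,
      set_fun [set s | lt (f s) (f x)] [set s | lt s (f x)] h &
      set_inj [set s | lt (f s) (f x)] h.
    by exists f => // y z _ _ /fI; exact.
  exact: inj_card_le.
by apply: contrapT; apply: tmin; exact: flt.
Qed.

(** * Strongly centered families *)

(** For [l = 0] alone this would be the finite intersection property; as [l] is
arbitrary the intersections are infinite, and the cofinite sets can be added to
[F]. *)
Definition centered (F : set (set nat)) := forall (s : seq (set nat)) l,
  (forall A, A \in s -> F A) -> exists2 i, l <= i & forall A, A \in s -> A i.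

Lemma sub_centered (F F' : set (set nat)) :
  F `<=` F' -> centered F' -> centered F.
Proof. by move=> FF' cF' s l sF; apply: cF' => A /sF/FF'. Qed.

Lemma centered_setT F : centered F -> centered (F `|` [set setT]).
Proof.
move=> cF s l sF; have [|i li si] := cF [seq A <- s | A != setT] l.
  by move=> A; rewrite mem_filter => /andP[/eqP AT /sF[]].
exists i => // A As; have [->//|AT] := eqVneq A setT.
by apply: si; rewrite mem_filter AT.
Qed.

Lemma centered_bigcup (C : set (set (set nat))) :
  total_on C subset -> C `<=` centered -> centered (\bigcup_(F in C) F).
Proof.
move=> totC cC [|A s] l sC; first by exists l.
have [//|F CF sF] := bigcup_chain_seq totC _ sC.
exact: cC _ CF _ _ sF.
Qed.

(** * Generic branches of a tree of finite sequences *)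

Definition init (q : nat -> bool) m : seq bool := mkseq q m.

Arguments init : simpl never.

Lemma nth_init q m i : i < m -> nth false (init q m) i = q i.
Proof. exact: nth_mkseq. Qed.

Lemma take_init q m n : m <= n -> take m (init q n) = init q m.
Proof.
by move=> mn; rewrite /init /mkseq -map_take take_iota (minn_idPl mn).
Qed.

Lemma size_init q n : size (init q n) = n.
Proof. exact: size_mkseq. Qed.

Definition node (S : set (seq bool)) := {s : seq bool | s \in S}.

Section node_order.
Variable S : set (seq bool).

HB.instance Definition _ := [Countable of node S by <:].

Definition node_le (p q : node S) := prefix (val q) (val p).

Lemma node_le_refl : reflexive node_le.
Proof. by move=> p; exact: prefix_refl. Qed.

Lemma node_le_anti : antisymmetric node_le.
Proof.
move=> p q /andP[qp pq]; apply/val_inj.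
by move: pq; rewrite /node_le prefixE (take_oversize (size_prefix qp)) => /eqP.
Qed.

Lemma node_le_trans : transitive node_le.
Proof. by move=> q p r pq qr; exact: prefix_trans qr pq. Qed.

Fact node_display : Order.disp_t. Proof. exact: Order.Disp tt tt. Qed.

HB.instance Definition _ := Order.Le_isPOrder.Build node_display (node S)
  node_le_refl node_le_anti node_le_trans.

End node_order.

(** Members of a filter are pairwise compatible, so they are initial segments of a
single sequence. *)
Lemma filter_branch S (G : set (node S)) : poset_filter G ->
  exists q, forall p, G p -> init q (size (val p)) = val p.
Proof.
move=> [_ _ Gdir].
exists (fun i => `[< exists2 p, G p & nth false (val p) i >]) => p Gp.
apply: (@eq_from_nth _ false); rewrite size_mkseq// => i ip.
rewrite nth_mkseq//; apply/asboolP/idP => [[p' Gp' p'i]|pi]; last by exists p.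
have [r [_ rp rp']] := Gdir _ _ Gp Gp'.
have ip' : i < size (val p').
  by rewrite ltnNge; apply: contraL p'i => /(nth_default false) ->.
move: rp rp'; rewrite /Order.le/= /node_le => /prefixP[u ru] /prefixP[v rv].
have <- : nth false (val r) i = nth false (val p) i by rewrite ru nth_cat ip.
by rewrite rv nth_cat ip'.
Qed.

(** Only arbitrarily long initial segments of [q] are required to be in [S].  That
is what a filter meeting the dense sets gives, and it is enough for [q] to be a
limit of points whose initial segments are the members of [S]. *)
Definition on_tree (S : set (seq bool)) (D : nat -> set (seq bool))
    (q : nat -> bool) :=
  (forall l, exists2 m, l <= m & S (init q m)) /\
  (forall n, exists m, D n (init q m)).

(** This is what makes the dense sets of [generic_branch] dense.  For the pairs
[(S, D)] that come from a closed subset of an ultrafilter extending [F], points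
of that subset serve as [A]. *)
Definition rich (F : set (set nat)) (S : set (seq bool))
    (D : nat -> set (seq bool)) :=
  forall n s, S s -> exists2 A, centered (F `|` [set A]) &
    let q := char_fun A in
    [/\ init q (size s) = s, forall m, S (init q m) & exists m, D n (init q m)].

(** To extend a node [s] into the dense set of index [(n, T)], follow a branch
through [s] that meets [D n] and keeps [F] centered: it takes the value [1] at
arbitrarily large elements of the intersection of [T]. *)
Lemma generic_branch (MA : MA_countable) (F : set (set nat))
    (S : set (seq bool)) (D : nat -> set (seq bool)) :
  card_lt F continuum -> S !=set0 -> rich F S D ->
  exists2 A, centered (F `|` [set A]) & on_tree S D (char_fun A).
Proof.
move=> Fc [s0 Ss0] Srich.
pose E (p : nat * seq F) : set (node S) := [set s |
  (exists m, D p.1 (take m (val s))) /\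
  exists i, [/\ p.1 <= i, i < size (val s), nth false (val s) i
             & forall A, A \in map val p.2 -> A i]].
have [||||G [Gfilter GE]] := MA _ (node S) (range E).
- by exists (exist _ s0 (mem_set Ss0)).
- exact: countableP.
- move=> _ [[n T] _ <-] s.
  have [A Acen [As AS [m AD]]] := Srich n (val s) (set_mem (valP s)).
  have [|i li iT] := Acen (A :: map val T) (maxn n (maxn m (size (val s)))).
    move=> B; rewrite inE => /predU1P[->|/mapP[C _ ->]]; first by right.
    by left; exact: set_mem (valP C).
  move: li; rewrite !geq_max => /and3P[ni mi si].
  have [t tE] : exists t : node S, val t = init (char_fun A) i.+1.
    by exists (SigSub (mem_set (AS i.+1)) : node S).
  exists t.
    split; rewrite tE; first by exists m; rewrite take_init// leqW.
    exists i; split; rewrite ?size_init ?nth_init//.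
      by apply: mem_set; apply: iT; exact: mem_head.
    by move=> B BT; apply: iT; rewrite inE BT orbT.
  rewrite /Order.le/= /node_le prefixE tE take_init ?leqW//.
  by rewrite As.
- apply: (@card_lt_trans_le _ _ _ _ [set: nat * seq F]).
    exact: card_image_le.
  apply: card_lt_nat_seq.
  by rewrite card_ltE (card_le_eqr (card_setT _)) -card_ltE.
have [q qG] := filter_branch Gfilter.
have GEq n (T : seq F) : exists2 p, G p &
    [/\ exists m, D n (init q m), size (val p) > n &
        exists i, [/\ n <= i, q i & forall A, A \in map val T -> A i]].
  have [p [Gp [[m Dm] [i [ni ip pi iT]]]]] := GE _ (imageP E (I : setT (n, T))).
  exists p => //; split; last 1 first.
  - by exists i; split=> //; move: pi; rewrite -(qG _ Gp) nth_init.
  - exists (minn m (size (val p))).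
    move: Dm; rewrite -{1}(qG _ Gp).
    have [mp|pm] := leqP m (size (val p)); first by rewrite take_init.
    by rewrite take_oversize// size_init ltnW.
  - exact: leq_ltn_trans ip.
exists [set i | q i].
  move=> s l sF.
  have [p _ [_ _ [i [li qi iT]]]] := GEq l (pmap insub s).
  exists i => // A As; have [FA|->//] := sF A As.
  apply: iT; rewrite pmap_filter; last exact: insubK.
  by rewrite mem_filter As andbT insubT; first exact: mem_set.
have qE : char_fun [set i | q i] = q.
  by apply/funext => i; apply/idP/idP => [/set_mem//|qi]; exact: mem_set.
rewrite qE; split=> n; have [p Gp [? np _]] := GEq n [::] => //.
exists (size (val p)); first exact: ltnW.
by rewrite qG//; exact: set_mem (valP p).
Qed.

(** * The transfinite construction *)

(** Step [t] adds a set that is good for [t] and keeps the family centered, if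
there is one, and otherwise [setT], which is harmless.  Unions of
earlier families stay centered by [centered_bigcup]; [F'] is the family available
just before step [t]. *)
Lemma transfinite_centered (T : Type) (lt : T -> T -> Prop)
    (good : T -> set nat -> Prop) : strict_wo lt ->
  exists F, centered F /\ forall t, exists F', [/\ F' `<=` F,
    F' #<= [set s | lt s t] &
    (exists A, centered (F' `|` [set A]) /\ good t A) ->
    exists2 A, F A & good t A].
Proof.
move=> [wf tr tot].
pose next (F : set (set nat)) t :=
  if pselect (exists A, centered (F `|` [set A]) /\ good t A) is left e
  then projT1 (cid e) else setT.
have next_centered F t : centered F -> centered (F `|` [set next F t]).
  move=> cF; rewrite /next; case: pselect => [e|_]; last exact: centered_setT.
  by case: (cid e) => A [].
have next_good F t : (exists A, centered (F `|` [set A]) /\ good t A) ->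
    good t (next F t).
  by rewrite /next; case: pselect => // e _; case: (cid e) => A [].
pose step t (rec : forall s, lt s t -> set nat) :=
  next [set A | exists s (st : lt s t), rec s st = A] t.
pose x := Fix wf (fun=> set nat) step.
pose F t := x @` [set s | lt s t].
have xE t : x t = next (F t) t.
  rewrite /x Fix_eq => [|s f g fg]; last first.
    by rewrite /step; congr next; apply/seteqP; split=> A [u [us <-]];
       exists u, us; rewrite fg.
  rewrite /step; congr next; apply/seteqP; split=> A.
    by case=> s [st <-]; exists s.
  by case=> s st <-; exists s, st.
pose G t := F t `|` [set x t].
have GS s t : lt s t -> G s `<=` G t.
  move=> st A [[u us <-]|->]; left; last by exists s.
  by exists u => //; exact: tr us st.
have totG (B : set T) : total_on (G @` B) subset.
  move=> _ _ [s _ <-] [t _ <-]; have [->|/GS st|/GS ts] := tot s t.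
  - by left.
  - by left.
  - by right.
have FE t : F t = \bigcup_(H in G @` [set s | lt s t]) H.
  apply/seteqP; split=> A.
    by case=> s st <-; exists (G s); [exists s|right].
  case=> _ [s st <-] [[u us <-]|->]; last by exists s.
  by exists u => //; exact: tr us st.
have cG t : centered (G t).
  elim/(well_founded_ind wf) : t => t IH.
  rewrite /G xE; apply: next_centered; rewrite FE; apply: centered_bigcup => //.
  by move=> _ [s st <-]; exact: IH.
exists (\bigcup_(H in range G) H); split.
  by apply: centered_bigcup => // _ [t _ <-].
move=> t; exists (F t); split.
- by move=> A FA; exists (G t); [exists t|left].
- exact: card_image_le.
- move=> /next_good tgood; exists (x t); last by rewrite xE.
  by exists (G t); [exists t|right].
Qed.

(** The steps are indexed by the pairs [(S, D)], each coded as one set of pairs: the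
tree [S] at index [0] and [D n] at index [n.+1].  The order comes from
[exists_short_wo], so that Martin's axiom applies at each step. *)
Lemma exists_generic_centered (MA : MA_countable) :
  exists2 F, centered F & forall S D, S !=set0 -> rich F S D ->
    exists2 A, F A & on_tree S D (char_fun A).
Proof.
pose T := set (nat * seq bool).
have [|lt wo short] := @exists_short_wo T.
  apply/card_leTP.
  exists (fun t k => if unpickle k is Some p then p \in t else false).
  move=> t u tu; apply/funext => p; apply/propext.
  have := congr1 (fun f => f (pickle p)) tu; rewrite pickleK => e.
  by rewrite -[t p]in_setE -[u p]in_setE e.
have [F [cF FT]] := @transfinite_centered T lt (fun t A =>
  on_tree [set s | t (0, s)] (fun n => [set s | t (n.+1, s)]) (char_fun A)) wo.
exists F => // S D S0 Srich.
pose t : T := [set p | if p.1 is n.+1 then D n p.2 else S p.2].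
have [F' [F'F F't]] := FT t; apply.
have [||A cA At] := @generic_branch MA F' S D _ S0.
- exact: card_lt_trans_le F't (short t).
- move=> n s /(Srich n)[A cA AS]; exists A => //.
  by apply: sub_centered cA; exact: setSU.
- by exists A.
Qed.

(** Extend the filter generated by [F] and the cofinite sets. *)
Lemma centered_ultrafilter F : centered F -> exists U : set_system nat,
  [/\ UltraFilter U, nonprincipal U, F `<=` U & centered U].
Proof.
move=> cF.
pose B := [set A : set nat | exists (s : seq (set nat)) l,
  (forall A, A \in s -> F A) /\
  forall i, l <= i -> (forall A, A \in s -> A i) -> A i].
have BF : ProperFilter B.
  split.
    by move=> [s [l [sF sl]]]; have [i li si] := cF s l sF; exact: sl li si.
  split.
  - by exists [::], 0.
  - move=> P Q [s [l [sF sP]]] [s' [l' [s'F s'Q]]].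
    exists (s ++ s'), (maxn l l'); split.
      by move=> A; rewrite mem_cat => /orP[/sF|/s'F].
    move=> i; rewrite geq_max => /andP[li l'i] ss'; split.
      by apply: sP => // A As; apply: ss'; rewrite mem_cat As.
    by apply: s'Q => // A As; apply: ss'; rewrite mem_cat As orbT.
  - move=> P Q PQ [s [l [sF sP]]]; exists s, l; split=> // i li si.
    exact/PQ/sP.
have [U [UU BU]] := ultraFilterLemma BF.
have Utail l : U [set i | l <= i].
  by apply: BU; exists [::], l.
exists U; split=> //.
- move=> n Un; have := Utail n.+1.
  by rewrite Un => /principal_filterP; rewrite /= ltnn.
- move=> A FA; apply: BU; exists [:: A], 0; split.
    by move=> C; rewrite inE => /eqP ->.
  by move=> i _; apply; exact: mem_head.
- move=> s l sU.
  have : U [set i | l <= i /\ forall A, A \in s -> A i].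
    elim: s sU => [|A s IH] sU.
      by apply: filterS (Utail l) => i li; split.
    have UA : U A by apply: sU; exact: mem_head.
    have {}/IH Us C : C \in s -> U C.
      by move=> Cs; apply: sU; rewrite inE Cs orbT.
    apply: filterS (filterI UA Us) => i [Ai [li si]]; split=> // C.
    by rewrite inE => /predU1P[->|/si].
  by move=> /filter_ex[i [li si]]; exists i.
Qed.

(** * Complete Baireness *)

(** If no cylinder around [q] were contained in [W], points outside [W] agreeing
with [q] further and further would converge to [q]. *)
Lemma open_cantorP (W : set cantor_space) (q : cantor_space) : open W -> W q ->
  exists m, forall p : cantor_space, init p m = init q m -> W p.
Proof.
move=> oW Wq; apply: contrapT => nW.
have /choice[p pP] : forall m,
    exists p : cantor_space, init p m = init q m /\ ~ W p.
  move=> m; apply: contrapT => np; apply: nW; exists m => p pq.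
  by apply: contrapT => Wp; apply: np; exists p.
have pq : p @ \oo --> q.
  apply/cvg_sup => i N [V] [[Z] oZ <-] Zqi ZN.
  apply: (filterS ZN); rewrite nbhs_simpl; exists i.+1 => // m /= im.
  suff pqi : p m i = q i by move: Zqi; rewrite /= /proj pqi.
  by rewrite -(nth_init (p m) im) -(nth_init q im); have [-> _] := pP m.
have : \forall m \near \oo, W (p m) by apply: pq; exact: open_nbhs_nbhs.
by move=> /filter_ex[m]; have [] := pP m.
Qed.

Lemma open_cylinder (q : cantor_space) m :
  open [set p : cantor_space | init p m = init q m].
Proof.
elim: m => [|m IH].
  by rewrite (_ : [set _ | _] = setT); [exact: openT|apply/seteqP; split].
have -> : [set p : cantor_space | init p m.+1 = init q m.+1] =
    [set p : cantor_space | init p m = init q m] `&` proj m @^-1` [set q m].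
  apply/seteqP; split=> p; rewrite /init /= mkseqS mkseqS.
    by move=> /rcons_inj[].
  by move=> [-> pm]; congr rcons.
apply: openI => //; apply: open_comp; last exact: discrete_open.
by move=> p _; exact: proj_continuous.
Qed.

Lemma open_set_typeP (X : topologicalType) (A : set X) (O : set (set_type A)) :
  open O -> exists2 W, open W & O = set_val @^-1` W.
Proof. by move=> [W oW <-]; exists W. Qed.

Lemma open_set_type_preimage (X : topologicalType) (A : set X) (W : set X) :
  open W -> open (set_val @^-1` W : set (set_type A)).
Proof. by exists W. Qed.
Arguments open_set_type_preimage {X} A {W}.

(** The members of [U] in the closed set [C] make the pair [(S, D)] below rich over
[F], so [F] contains some [A] for it.  The condition on [S] puts [A] in [C], and
the conditions on [D] put it in [V] and in each [O n]. *)
Lemma generic_completely_baire (U F : set (set nat)) : F `<=` U -> centered U ->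
  (forall S D, S !=set0 -> rich F S D ->
    exists2 A, F A & on_tree S D (char_fun A)) ->
  completely_baire (set_type (char_set U)).
Proof.
move=> FU cU generic C clC O Odense V [v0 Vv0] oV.
pose branch (y : set_type C) : cantor_space := set_val (set_val y).
have openP (W : set (set_type C)) y : open W -> W y -> exists m, forall z,
    init (branch z) m = init (branch y) m -> W z.
  move=> /open_set_typeP[_ /open_set_typeP[W' oW' ->] ->] Wy.
  by have [m mW] := open_cantorP oW' Wy; exists m => z /mW.
pose S := [set s | exists2 y, V y & init (branch y) (size s) = s].
pose D n := [set s | forall y, init (branch y) (size s) = s -> V y /\ O n y].
have [|n s [y0 Vy0 y0s]|A FA [AS AD]] := generic S D.
- by exists [::]; exists v0.
- have [oO dO] := Odense n.
  have oVs : open (V `&` [set y | init (branch y) (size s) = s]).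
    apply: openI => //.
    have -> : [set y | init (branch y) (size s) = s] = branch @^-1`
      [set p : cantor_space | init p (size s) = init (branch y0) (size s)].
      by rewrite y0s.
    have := open_cylinder (branch y0) (size s).
    by move=> /(open_set_type_preimage (char_set U))/(open_set_type_preimage C).
  have Vs0 : V `&` [set y | init (branch y) (size s) = s] !=set0 by exists y0.
  have [y [[Vy ys] Oy]] := dO _ Vs0 oVs.
  have [A UA yA] : char_set U (branch y) by exact: set_valP.
  exists A.
    by apply: sub_centered cU => B [/FU//|->].
  rewrite yA; split=> [//|m|]; first by exists y; rewrite ?size_init.
  have [m mVO] := openP _ y (openI oV oO) (conj Vy Oy).
  by exists m => z; rewrite size_init => /mVO.
have UxA : char_set U (char_fun A) by exists A => //; exact: FU.
pose x : set_type (char_set U) := SigSub (mem_set UxA).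
have Cx : C x.
  apply: contrapT => nCx.
  have /open_set_typeP[W oW CW] : open (~` C) by exact: closed_openC.
  have [m mW] : exists m, forall p : cantor_space,
      init p m = init (char_fun A) m -> W p.
    apply: open_cantorP => //.
    by have : (~` C) x by []; rewrite CW.
  have [m' mm' [y _]] := AS m; rewrite size_init => ym'.
  have : (~` C) (set_val y).
    rewrite CW; apply: mW.
    by rewrite -(take_init _ mm') -(take_init (char_fun A) mm') -ym'.
  by apply; exact: set_valP.
pose z : set_type C := SigSub (mem_set Cx).
have zVO n : V z /\ O n z.
  by have [m] := AD n; apply; rewrite size_init.
exists z; split; first by case: (zVO 0).
by move=> n _; case: (zVO n).
Qed.

Theorem theorem11 (MA : MA_countable) :
  exists U : set_system nat,
    [/\ UltraFilter U, nonprincipal U & completely_baire (set_type (char_set U))].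
Proof.
have [F cF generic] := exists_generic_centered MA.
have [U [UU npU FU cU]] := centered_ultrafilter cF.
exists U; split=> //; exact: generic_completely_baire FU cU generic.
Qed.
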